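(* For any prime $p\ge 5$, \[ \sum_{k=0}^{p-1}\frac{2k+1}{(-9)^k}\gamma_k\equiv \left(\frac{-3}{p}\right)p\pmod{p^3}. \]
   Context: For $n\ge 0$, the Almkvist--Zudilin numbers are \[ \gamma_n=\sum_{j=0}^{n}(-1)^{n-j}\frac{3^{n-3j}(3j)!}{(j!)^3}\binom{n}{3j}\binom{n+j}{j}. \] $\left(\frac{\cdot}{p}\right)$ denotes the Legendre symbol. *)

(* Defs.v *)
From HB Require Import structures.
From mathcomp Require Import all_boot all_order all_algebra.

Set Implicit Arguments.
Unset Strict Implicit.
Unset Printing Implicit Defensive.

Import GRing.Theory.
Local Open Scope ring_scope.

(* The power of 3 has an integer (possibly negative) exponent, so the value
   is taken in rat; the terms with n < 3j vanish because 'C(n, 3j) = 0. *)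
Definition AZ (n : nat) : rat :=
  \sum_(0 <= j < n.+1)
    (-1) ^+ (n - j)
    * (3%:R ^ (n%:Z - (3 * j)%N%:Z) * ((3 * j)`!)%:R / (j`!)%:R ^+ 3)
    * ('C(n, 3 * j))%:R * ('C(n + j, j))%:R.

(* Meaningful for p an odd prime. *)
Definition legendre (a : int) (p : nat) : int :=
  if (a%:~R : 'F_p) == 0 then 0
  else if [exists x : 'F_p, x ^+ 2 == a%:~R] then 1 else -1.

Definition p_integral (p : nat) (x : rat) : bool := ~~ (p%:Z %| denq x)%Z.

(* Congruence modulo p ^ e in the ring of rationals with denominator prime
   to p. *)
Definition eqmod_rat (p e : nat) (x y : rat) : Prop :=
  exists2 z : rat, p_integral p z & x - y = p%:R ^+ e * z.

(* Main.v *)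
Require Import Defs.
From mathcomp Require Import all_boot all_order all_algebra.
From mathcomp Require Import finfield.
From mathcomp Require Import ring zify.

(**
Write [a k] for [\sum_i 'C(k, i)^2 'C(2i, i)].  Comparing recurrences,
[AZ n = (-9)^n \sum_k 'C(n, k) 'C(n + k, k) (-9)^-k a k], and summing over [n]
  [\sum_(n < p) (2n+1)(-9)^-n AZ n
     = p \sum_(k < p) (-9)^-k a k 'C(p, k+1) 'C(p + k, k)].
The terms [k < p - 1] add up to 0 mod [p^2]: after division by [p] they
become [\sum_k 9^-k a k / (k + 1)] mod [p], which the reflection
[a (p-1-k) = a (p-1) 9^-k a k] turns into a multiple of
[\sum_(0 < m < p) a m / m], and this vanishes mod [p] by Vandermonde.
There remains [a (p-1) = (p/3) 9^(p-1)] mod [p^2].  As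
['C(p-1, j)^2 = 2 (-1)^j 'C(p-1, j) - 1] mod [p^2], it follows from
  [\sum_(j < p) 'C(2j, j) = (p/3)] and
  [\sum_j (-1)^j 'C(p-1, j) 'C(2j, j) = 2 (-3)^((p-1)/2) - (p/3)]  mod [p^2];
these are coefficients of [(1+x)^(2p) / (1+x+x^2)] and [(1+x+x^2)^p / (1+x+x^2)],
and their congruence mod [p] also yields [(-3)^((p-1)/2) = (p/3)] mod [p].
*)

Set Implicit Arguments.
Unset Strict Implicit.
Unset Printing Implicit Defensive.

Import GRing.Theory Num.Theory.
Local Open Scope ring_scope.

(** * Steps between neighbouring binomial coefficients *)

Lemma mul_bin_leftr (R : pzRingType) (n k : nat) :
  k.+1%:R * 'C(n, k.+1)%:R = (n%:R - k%:R) * 'C(n, k)%:R :> R.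
Proof.
case: (leqP k n) => le_kn; first by rewrite -natrB // -!natrM mul_bin_left.
by rewrite !bin_small ?mulr0 // ltnW.
Qed.

Lemma bin_stepE (F : numFieldType) (n k : nat) :
  'C(n, k.+1)%:R = (n%:R - k%:R) * 'C(n, k)%:R / k.+1%:R :> F.
Proof. by rewrite -mul_bin_leftr mulrAC divff ?mul1r // pnatr_eq0. Qed.

(** * Recurrence of the Almkvist--Zudilin numbers by creative telescoping *)

Definition az_coef (j : nat) : rat := ((4 * j)`!)%:R / (j`!)%:R ^+ 4.
(** The [j]-th summand of [AZ n] divided by (-9)^n, with (3j)!/j!^3 C(n, 3j) C(n+j, j) merged into
    [az_coef j] times the single binomial C(n+j, 4j). *)
Definition az_term (n j : nat) : rat :=
  3%:R ^- n / (-27%:R) ^+ j * az_coef j * ('C(n + j, 4 * j))%:R.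

Lemma az_coefS j : az_coef j.+1 =
  (4 * j + 4)%:R * (4 * j + 3)%:R * (4 * j + 2)%:R * (4 * j + 1)%:R / j.+1%:R ^+ 4 * az_coef j.
Proof.
rewrite /az_coef (_ : (4 * j.+1 = (4 * j).+4)%N); last by lia.
rewrite !factS !natrM -!addnS.
have H : (j`!)%:R != 0 :> rat by rewrite pnatr_eq0 -lt0n fact_gt0.
by field; rewrite H addrC natr1 pnatr_eq0.
Qed.

(* Zeilberger's certificate: [az_cert n j] is
   [- 12 (4n + 1) j^4 / ((n + j) (n + 1 - 3j)) * az_term n j], rewritten so
   as to make sense at [3j = n + 1]; the junk denominator at [j = 0] is harmless
   thanks to the factor [j^3]. *)
Definition az_cert (n j : nat) : rat :=
  - 12%:R * (4 * n + 1)%:R * 3%:R ^- n / (-27%:R) ^+ j * az_coef j * j%:R ^+ 3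
   / (4 * (4 * j - 1))%:R * 'C(n + j - 1, 4 * j - 2)%:R.

(** The Almkvist--Zudilin recurrence (n+2)^3 u(n+2) + (2n+3)(7(n+1)^2 + 7(n+1) + 3) u(n+1) + 81
    (n+1)^3 u(n) = 0, rewritten for v(n) = u(n) / (-9)^n. As an operator on sequences it applies to
    sums and to single summands alike. *)
Definition az_rec (R : fieldType) (v : nat -> R) n : R :=
 (n.+2)%:R ^+ 3 * v n.+2
   - (2 * n + 3)%:R * (7%:R * n.+1%:R ^+ 2 + 7%:R * n.+1%:R + 3%:R) / 9%:R * v n.+1
   + n.+1%:R ^+ 3 * v n.

Lemma az_term_telescope n j :
  az_rec (az_term ^~ j) n = az_cert n.+1 j.+1 - az_cert n.+1 j.
Proof.
have h3 : (3 : rat) ^+ n != 0 by rewrite expf_neq0.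
have h27 : (-27 : rat) ^+ j != 0 by rewrite expf_neq0.
rewrite /az_rec /az_term /az_cert az_coefS.
rewrite (_ : (n.+1 + j.+1 - 1 = (n + j).+1)%N); last by lia.
rewrite (_ : (n.+2 + j = (n + j).+2)%N) //.
rewrite (_ : (n.+1 + j = (n + j).+1)%N) //.
rewrite (_ : (4 * j.+1 - 2 = (4 * j).+2)%N); last by lia.
rewrite (_ : (4 * j.+1 - 1 = (4 * j).+3)%N); last by lia.
(* Truncated subtraction in [az_cert] at [j = 0] sets this case apart. *)
case: j h27 => [_|j h27].
  rewrite !muln0 !addn0 !bin0 !bin_stepE bin0 (expr0n _ 3) !mulr0 !mul0r subr0 !exprS.
  by field; rewrite h3.
rewrite (_ : (4 * j.+1 - 2 = (4 * j).+2)%N); last by lia.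
rewrite (_ : (4 * j.+1 - 1 = (4 * j).+3)%N); last by lia.
rewrite (_ : (4 * j.+1 = (4 * j).+4)%N); last by lia.
rewrite (_ : ((n + j.+1).+1 - 1 = (n + j.+1))%N); last by lia.
(* All binomials become multiples of ['C(n + j.+1, (4 * j).+2)], which leaves an identity of
   rational functions. *)
rewrite !binS !natrD !(bin_stepE _ _ _.+2).
move: ('C(n + j.+1, (4 * j).+2)%:R) (az_coef j.+1) => b M.
rewrite !exprS in h27 *.
field.
rewrite h3 -!natrM -!natrD !pnatr_eq0 /= andbT.
by move: h27; rewrite mulf_eq0 negb_or => /andP[].
Qed.

Lemma az_rec_sum (R : fieldType) (I : Type) (r : seq I) (f : nat -> I -> R) n :
  az_rec (fun m => \sum_(i <- r) f m i) n = \sum_(i <- r) az_rec (f ^~ i) n.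
Proof.
rewrite /az_rec !mulr_sumr -sumrB -big_split /=.
by apply: eq_bigr.
Qed.

Lemma az_rec_unique (u v : nat -> rat) :
    u 0%N = v 0%N -> u 1%N = v 1%N ->
    (forall n, az_rec u n = 0) -> (forall n, az_rec v n = 0) -> u =1 v.
Proof.
move=> uv0 uv1 u_rec v_rec n.
suff [] : u n = v n /\ u n.+1 = v n.+1 by [].
elim: n => [//|n [IH0 IH1]]; split=> //.
have n2_neq0 : n.+2%:R ^+ 3 != 0 :> rat by rewrite expf_neq0 // pnatr_eq0.
apply: (mulfI n2_neq0); have := v_rec n; rewrite -(u_rec n) /az_rec IH0 IH1.
by move=> /addIr/addIr.
Qed.

Lemma widen_sum0 (V : zmodType) (m n : nat) (F : nat -> V) :
  (m <= n)%N -> (forall i, (m <= i)%N -> F i = 0) ->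
  \sum_(0 <= i < n) F i = \sum_(0 <= i < m) F i.
Proof.
move=> le_mn F0; rewrite (@big_cat_nat _ _ _ m) //= [X in _ + X]big1_seq ?addr0 //.
by move=> i /andP[_]; rewrite mem_index_iota => /andP[? _]; apply: F0.
Qed.

Lemma az_term_eq0 n j : (n < 3 * j)%N -> az_term n j = 0.
Proof. by move=> lt_nj; rewrite /az_term bin_small ?mulr0 //; lia. Qed.

Definition az_scaled (n : nat) : rat := \sum_(0 <= j < n.+1) az_term n j.

Lemma az_scaled_widen n m : (n <= m)%N -> az_scaled n = \sum_(0 <= j < m.+1) az_term n j.
Proof.
by move=> le_nm; rewrite (widen_sum0 (m := n.+1)) // => i ?; apply: az_term_eq0; lia.
Qed.

(** Telescoping leaves [az_cert] at [j = 0], killed by j^3, and at [j = n.+3], where the binomial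
    vanishes. *)
Lemma az_scaled_rec n : az_rec az_scaled n = 0.
Proof.
rewrite -[LHS]/(az_rec az_scaled n) {1}/az_rec.
rewrite (az_scaled_widen (_ : n <= n.+2)%N) ?(az_scaled_widen (_ : n.+1 <= n.+2)%N) //; try lia.
rewrite -/(az_rec (fun i => \sum_(0 <= j < n.+3) az_term i j) n) az_rec_sum.
under eq_bigr do rewrite az_term_telescope.
rewrite telescope_sumr // /az_cert bin_small; last by lia.
by rewrite !(mulr0, mul0r) subrr.
Qed.

Lemma AZ_az_scaled n : AZ n = (-9%:R) ^+ n * az_scaled n.
Proof.
rewrite /AZ /az_scaled mulr_sumr; apply: eq_big_nat => j /andP[_ lt_jn].
(* Where [n < 3 * j] both summands vanish, so no negative power of 3 contributes. *)
have [lt_n3j|le_3jn] := ltnP n (3 * j).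
  by rewrite az_term_eq0 // bin_small // !(mulr0, mul0r).
rewrite /az_term /az_coef (_ : n%:Z - (3 * j)%N%:Z = (n - 3 * j)%N%:Z); last by lia.
rewrite -exprnP.
have /(congr1 (fun k => k%:R : rat)) e1 := bin_fact le_3jn.
have le_jn : (j <= n + j)%N by lia.
have /(congr1 (fun k => k%:R : rat)) e2 := bin_fact le_jn.
have le_4jn : (4 * j <= n + j)%N by lia.
have /(congr1 (fun k => k%:R : rat)) e3 := bin_fact le_4jn.
rewrite !natrM addnK (_ : n + j - 4 * j = n - 3 * j)%N in e1 e2 e3; last by lia.
have f_neq0 k : (k`!)%:R != 0 :> rat by rewrite pnatr_eq0 -lt0n fact_gt0.
have -> : 'C(n, 3 * j)%:R = (n`!)%:R / ((3 * j)`!%:R * (n - 3 * j)`!%:R) :> rat.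
  by rewrite -e1 mulfK // mulf_neq0.
have -> : 'C(n + j, j)%:R = ((n + j)`!)%:R / (j`!%:R * n`!%:R) :> rat.
  by rewrite -e2 mulfK // mulf_neq0.
have -> : 'C(n + j, 4 * j)%:R = ((n + j)`!)%:R / ((4 * j)`!%:R * (n - 3 * j)`!%:R) :> rat.
  by rewrite -e3 mulfK // mulf_neq0.
have -> : (-9%:R) ^+ n = (-1) ^+ n * 3%:R ^+ (3 * j) * 3%:R ^+ n * 3%:R ^+ (n - 3 * j) :> rat.
  rewrite (_ : -9%:R = -1 * 3%:R ^+ 2 :> rat) // exprMn -exprM -!mulrA -!exprD.
  by congr (_ * _ ^+ _); lia.
have -> : (-27%:R) ^+ j = (-1) ^+ j * 3%:R ^+ (3 * j) :> rat.
  by rewrite (_ : -27%:R = -1 * 3%:R ^+ 3 :> rat) // exprMn -exprM.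
have -> : (-1) ^+ n = (-1) ^+ (n - j) * (-1) ^+ j :> rat.
  by rewrite -exprD subnK.
field.
by rewrite !f_neq0 !expf_neq0.
Qed.

(** * The numbers a(n) and their recurrence *)

(** The sequence 1, 3, 15, 93, ..., which counts closed walks of length 2n on the honeycomb
    lattice. *)
Definition honeycomb (n : nat) : nat := \sum_(0 <= k < n.+1) 'C(n, k) ^ 2 * 'C(2 * k, k).

Lemma honeycomb_widen (R : nzRingType) n m : (n <= m)%N ->
  (honeycomb n)%:R = \sum_(0 <= k < m.+1) ('C(n, k) ^ 2 * 'C(2 * k, k))%N%:R :> R.
Proof.
move=> le_nm; rewrite natr_sum [RHS](widen_sum0 (m := n.+1)) // => i lt_ni.
by rewrite bin_small.
Qed.

Lemma central_binS (k : nat) :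
  'C(2 * k.+1, k.+1)%:R = (4 * k + 2)%:R / k.+1%:R * 'C(2 * k, k)%:R :> rat.
Proof.
have e : 'C(2 * k.+1, k.+1)%:R = 2%:R * 'C((2 * k).+1, k.+1)%:R :> rat.
  have sub : 'C((2 * k).+1, k) = 'C((2 * k).+1, k.+1).
    by rewrite -bin_sub; [congr 'C(_, _); lia | lia].
  rewrite (_ : 2 * k.+1 = (2 * k).+2)%N; last by lia.
  by rewrite binS sub natrD; ring.
rewrite e binS natrD bin_stepE.
by field; rewrite addrC natr1 pnatr_eq0.
Qed.

(* Zeilberger's certificate, with [m = n + 1]: [G k] is
   [(3k - 4m - 4) k^3 / (m + 1 - k)^2] times the summand. *)
Lemma honeycomb_telescope (n k : nat) :
  let s m := ('C(m, k) ^ 2 * 'C(2 * k, k))%N%:R : rat in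
  let G k := (3%:R * k%:R - 4%:R * n%:R - 8%:R) * k%:R *
    ('C(n.+1, k - 1) ^ 2 * 'C(2 * k, k))%N%:R in
  n.+2%:R ^+ 2 * s n.+2 - (10%:R * n.+1%:R ^+ 2 + 10%:R * n.+1%:R + 3%:R) * s n.+1
    + 9%:R * n.+1%:R ^+ 2 * s n = G k.+1 - G k :> rat.
Proof.
rewrite /= subn1 !(natrM _ (_ ^ 2)) !natrX central_binS.
case: k => [|k]; first by rewrite !bin0 /=; field.
move: 'C(2 * k.+1, k.+1)%:R => c.
have diag m : 'C(m.+1, k.+1)%:R = m.+1%:R / k.+1%:R * 'C(m, k)%:R :> rat.
  have k_neq0 : k.+1%:R != 0 :> rat by rewrite pnatr_eq0.
  by apply: (mulfI k_neq0); rewrite -natrM -mul_bin_diag natrM; field; rewrite addrC natr1.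
rewrite !diag (bin_stepE _ n k).
have -> : 'C(n, k)%:R = (n.+1%:R - k%:R) / n.+1%:R * 'C(n.+1, k)%:R :> rat.
  have n_neq0 : n.+1%:R != 0 :> rat by rewrite pnatr_eq0.
  apply: (mulfI n_neq0); rewrite -natrM mul_bin_diag natrM mul_bin_leftr.
  by field; rewrite addrC natr1.
rewrite !subn1 /=; field.
by rewrite !nat1r -natrD !pnatr_eq0.
Qed.

Lemma honeycomb_rec (n : nat) :
  n.+2%:R ^+ 2 * (honeycomb n.+2)%:R =
    (10%:R * n.+1%:R ^+ 2 + 10%:R * n.+1%:R + 3%:R) * (honeycomb n.+1)%:R
    - 9%:R * n.+1%:R ^+ 2 * (honeycomb n)%:R :> rat.
Proof.
apply/eqP; rewrite -subr_eq0 opprB addrA addrAC; apply/eqP.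
rewrite (@honeycomb_widen _ n.+2 n.+2) // (@honeycomb_widen _ n.+1 n.+2) //.
rewrite (@honeycomb_widen _ n n.+2); last by lia.
rewrite !mulr_sumr -sumrB -big_split /=.
under eq_bigr do rewrite honeycomb_telescope.
by rewrite telescope_sumr // bin_small // exp0n // mul0n !mulr0 mul0r subrr.
Qed.

(** * The Almkvist--Zudilin numbers as a Legendre transform of a(n) *)

(** Coefficient of x^k in the shifted Legendre polynomial P_n(1 + 2x). *)
Definition legendre_coef (n k : nat) : nat := 'C(n, k) * 'C(n + k, k).

Lemma legendre_coef_small n k : (n < k)%N -> legendre_coef n k = 0%N.
Proof. by move=> ?; rewrite /legendre_coef bin_small. Qed.

Lemma legendre_coefS (R : numFieldType) n k :
  (legendre_coef n k.+1)%:R =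
    (n%:R * n.+1%:R - k%:R * k.+1%:R) / k.+1%:R ^+ 2 * (legendre_coef n k)%:R :> R.
Proof.
have k_neq0 : k.+1%:R != 0 :> R by rewrite pnatr_eq0.
rewrite /legendre_coef !natrM bin_stepE addnS.
have -> : 'C((n + k).+1, k.+1)%:R = (n + k).+1%:R / k.+1%:R * 'C(n + k, k)%:R :> R.
  by apply: (mulfI k_neq0); rewrite -natrM -mul_bin_diag natrM; field; rewrite addrC natr1.
by field; rewrite addrC natr1.
Qed.

Lemma legendre_coef_step (R : numFieldType) n k :
  (n.+1%:R - k%:R) * (legendre_coef n.+1 k)%:R = (n + k).+1%:R * (legendre_coef n k)%:R :> R.
Proof.
have n_neq0 : n.+1%:R != 0 :> R by rewrite pnatr_eq0.
apply: (mulfI n_neq0).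
have down : n.+1%:R * 'C(n.+1 + k, k)%:R = (n + k).+1%:R * 'C(n + k, k)%:R :> R.
  have := mul_bin_down (n + k).+1 k; rewrite subSn ?leq_addl // addnK /= => e.
  by rewrite addSn -!natrM -e.
have diag : (n.+1%:R - k%:R) * 'C(n.+1, k)%:R = n.+1%:R * 'C(n, k)%:R :> R.
  by rewrite -mul_bin_leftr -!natrM mul_bin_diag.
transitivity ((n.+1%:R - k%:R) * 'C(n.+1, k)%:R * (n.+1%:R * 'C(n.+1 + k, k)%:R) : R).
  by rewrite /legendre_coef natrM; ring.
by rewrite down diag /legendre_coef natrM; ring.
Qed.

(** Together with [legendre_coef_down], this brings the degrees n+2 and n back to degree n+1 with
    denominators in [k] only; a shift of the degree alone would divide by a difference that can be
    zero. *)
Lemma legendre_coef_up (R : numFieldType) n k :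
  (legendre_coef n.+1 k.+1)%:R =
    (n + k).+1%:R * (n + k).+2%:R / k.+1%:R ^+ 2 * (legendre_coef n k)%:R :> R.
Proof.
transitivity ((n + k).+2%:R / k.+1%:R ^+ 2 * ((n.+1%:R - k%:R) * (legendre_coef n.+1 k)%:R) : R).
  by rewrite legendre_coefS; field; rewrite nat1r pnatr_eq0.
by rewrite legendre_coef_step; ring.
Qed.

Lemma legendre_coef_down (R : numFieldType) n k :
  (legendre_coef n k.+1)%:R =
    (n.+1%:R - k%:R) * (n%:R - k%:R) / k.+1%:R ^+ 2 * (legendre_coef n.+1 k)%:R :> R.
Proof.
transitivity ((n%:R - k%:R) / k.+1%:R ^+ 2 * ((n.+1%:R - k%:R) * (legendre_coef n.+1 k)%:R) : R).
  by rewrite legendre_coef_step legendre_coefS; field; rewrite nat1r pnatr_eq0.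
by ring.
Qed.

Lemma honeycomb0 : honeycomb 0 = 1%N. Proof. by rewrite /honeycomb big_nat1. Qed.
Lemma honeycomb1 : honeycomb 1 = 3%N. Proof. by rewrite /honeycomb !big_nat_recl // big_nil. Qed.

(** At [k = 0] the factor k^2 cancels the default value [0.-1 = 0], so one formula also covers the
    initial step. *)
Lemma honeycomb_rec_pred (k : nat) :
  k.+1%:R ^+ 2 * (honeycomb k.+1)%:R = (10%:R * k%:R ^+ 2 + 10%:R * k%:R + 3%:R) * (honeycomb k)%:R
    - 9%:R * k%:R ^+ 2 * (honeycomb k.-1)%:R :> rat.
Proof. by case: k => [|k]; [rewrite honeycomb0 honeycomb1 | exact: honeycomb_rec]. Qed.

(* The right-hand side is the adjoint of the recurrence of [honeycomb], up to
   the factors [(-9)^-k]. *)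
Lemma legendre_coef_rec n k :
  az_rec (fun m => (legendre_coef m k)%:R) n = 2%:R / 9%:R * (2 * n + 3)%:R *
    (k.+1%:R ^+ 2 * (legendre_coef n.+1 k.+1)%:R
     + (10%:R * k%:R ^+ 2 + 10%:R * k%:R + 3%:R) * (legendre_coef n.+1 k)%:R
     + 9%:R * k%:R ^+ 2 * (legendre_coef n.+1 k.-1)%:R) :> rat.
Proof.
rewrite /az_rec; case: k => [|k].
  by rewrite legendre_coefS /legendre_coef /= !bin0; field.
rewrite [k.+1.-1]/= (legendre_coef_up _ n.+1) (legendre_coef_down _ n) !(legendre_coefS _ n.+1).
by field; rewrite nat1r -natrD !pnatr_eq0.
Qed.

Definition honeycomb_transform (n : nat) : rat :=
  \sum_(0 <= k < n.+1) (-9%:R) ^- k * (honeycomb k)%:R * (legendre_coef n k)%:R.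

Lemma honeycomb_transform_widen n m : (n <= m)%N ->
  honeycomb_transform n =
    \sum_(0 <= k < m.+1) (-9%:R) ^- k * (honeycomb k)%:R * (legendre_coef n k)%:R.
Proof.
move=> le_nm; rewrite [RHS](widen_sum0 (m := n.+1)) // => i lt_ni.
by rewrite legendre_coef_small ?mulr0.
Qed.

Lemma honeycomb_transform_rec n : az_rec honeycomb_transform n = 0.
Proof.
rewrite {1}/az_rec.
rewrite (@honeycomb_transform_widen n.+2 n.+2) // (@honeycomb_transform_widen n.+1 n.+2) //.
rewrite (@honeycomb_transform_widen n n.+2); last by lia.
rewrite -/(az_rec (fun i =>
  \sum_(0 <= k < n.+3) (-9%:R) ^- k * (honeycomb k)%:R * (legendre_coef i k)%:R) n).
rewrite az_rec_sum.
pose c k : rat := (-9%:R) ^- k * (honeycomb k)%:R.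
(* [H] is the boundary form of summation by parts between the recurrence of [c] and its adjoint. It
   vanishes at 0 by the factor k^2, and at [n.+3] because [legendre_coef n.+1] is zero beyond
   [n.+1]. *)
pose H k : rat := k%:R ^+ 2 *
  ((legendre_coef n.+1 k)%:R * c k.-1 - 9%:R * (legendre_coef n.+1 k.-1)%:R * c k).
have c_rec k : 9%:R * k.+1%:R ^+ 2 * c k.+1 =
    - (10%:R * k%:R ^+ 2 + 10%:R * k%:R + 3%:R) * c k - k%:R ^+ 2 * c k.-1.
  have -> : 9%:R * k.+1%:R ^+ 2 * c k.+1 = - (-9%:R) ^- k * (k.+1%:R ^+ 2 * (honeycomb k.+1)%:R).
    by rewrite /c (exprS _ k); field; rewrite expf_neq0.
  rewrite honeycomb_rec_pred /c; case: k => [|k] /=; first by field.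
  by rewrite (exprS _ k); field; rewrite expf_neq0.
under eq_bigr => k _.
  have -> : az_rec ((fun i k => (-9%:R) ^- k * (honeycomb k)%:R * (legendre_coef i k)%:R)^~ k) n
      = 2%:R / 9%:R * (2 * n + 3)%:R * (H k.+1 - H k).
    transitivity (c k * az_rec (fun m => (legendre_coef m k)%:R) n).
      by rewrite /az_rec -/(c k); ring.
    rewrite legendre_coef_rec /H /=.
    have -> : k.+1%:R ^+ 2 * ((legendre_coef n.+1 k.+1)%:R * c k
          - 9 * (legendre_coef n.+1 k)%:R * c k.+1) =
       k.+1%:R ^+ 2 * (legendre_coef n.+1 k.+1)%:R * c k
         - (legendre_coef n.+1 k)%:R * (9%:R * k.+1%:R ^+ 2 * c k.+1) by ring.
    by rewrite c_rec; ring.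
  over.
rewrite -mulr_sumr telescope_sumr // /H (@legendre_coef_small n.+1 n.+3) //
   (@legendre_coef_small n.+1 n.+3.-1) //.
by rewrite !(mulr0, mul0r, subrr, expr0n).
Qed.

Lemma AZ_honeycomb_transform n : AZ n = (-9%:R) ^+ n * honeycomb_transform n.
Proof.
rewrite AZ_az_scaled; congr (_ * _); apply: az_rec_unique => //.
- rewrite /az_scaled /honeycomb_transform !big_nat1 /az_term /az_coef /legendre_coef honeycomb0 /=.
  by rewrite !muln0 !addn0 bin0 fact0.
- rewrite /az_scaled /honeycomb_transform !big_nat_recl // !big_nil honeycomb0 honeycomb1.
  by rewrite (@az_term_eq0 1 1) // /az_term /az_coef /legendre_coef /= !bin0 !bin1 !fact0.
- exact: az_scaled_rec.
- exact: honeycomb_transform_rec.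
Qed.

(** * Summation over n *)

(** Induction on [N]: after multiplication by k + 1 the step is N(N - k) + (k + 1)(2N + 1) = (N +
    1)(N + k + 1). *)
Lemma legendre_coef_sum (R : numFieldType) N k :
  \sum_(0 <= n < N) (2 * n + 1)%:R * (legendre_coef n k)%:R =
    (N * 'C(N, k.+1) * 'C(N + k, k))%N%:R :> R.
Proof.
elim: N => [|N IH]; first by rewrite big_nil !mul0n.
rewrite big_nat_recr //= IH.
have k_neq0 : k.+1%:R != 0 :> R by rewrite pnatr_eq0.
apply: (mulfI k_neq0); rewrite !natrM.
have diag : k.+1%:R * 'C(N.+1, k.+1)%:R = N.+1%:R * 'C(N, k)%:R :> R.
  by rewrite -!natrM mul_bin_diag.
have down : N.+1%:R * 'C(N.+1 + k, k)%:R = (N + k).+1%:R * 'C(N + k, k)%:R :> R.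
  have := mul_bin_down (N + k).+1 k; rewrite subSn ?leq_addl // addnK /= => e.
  by rewrite addSn -!natrM -e.
transitivity (N.+1%:R * 'C(N, k)%:R * (N.+1%:R * 'C(N.+1 + k, k)%:R) : R);
  last by rewrite -diag; ring.
rewrite down.
transitivity (N%:R * (k.+1%:R * 'C(N, k.+1)%:R) * 'C(N + k, k)%:R
  + k.+1%:R * ((2 * N + 1)%:R * ('C(N, k)%:R * 'C(N + k, k)%:R)) : R); first by ring.
by rewrite mul_bin_leftr; ring.
Qed.

Lemma AZ_sum N :
  \sum_(0 <= k < N) (2 * k + 1)%N%:R / (-9%:R) ^+ k * AZ k =
  N%:R * \sum_(0 <= k < N) (-9%:R) ^- k * (honeycomb k * 'C(N, k.+1) * 'C(N + k, k))%N%:R.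
Proof.
transitivity (\sum_(0 <= n < N) \sum_(0 <= k < N)
    (-9%:R) ^- k * (honeycomb k)%:R * ((2 * n + 1)%:R * (legendre_coef n k)%:R) : rat).
  apply: eq_big_nat => n /andP[_ lt_nN].
  rewrite AZ_honeycomb_transform mulrA divfK ?expf_neq0 //.
  rewrite (@honeycomb_transform_widen n N.-1); last by lia.
  rewrite prednK; last by lia.
  by rewrite mulr_sumr; apply: eq_bigr => k _; ring.
rewrite exchange_big /= mulr_sumr; apply: eq_bigr => k _.
by rewrite -mulr_sumr legendre_coef_sum !natrM; ring.
Qed.

(** * Units and binomial coefficients in characteristic p *)

(** Serves both fields of characteristic p, with [m = p], and rings where p^2 = 0, with
    [m = p ^ 2]. *)
Lemma natr_unit (R : comUnitRingType) (m k : nat) :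
  m%:R = 0 :> R -> (0 < m)%N -> coprime m k -> k%:R \is a @GRing.unit R.
Proof.
move=> m0 m_gt0 /eqP co_mk.
have [a _ /dvdnP[q]] := Bezoutl k m_gt0.
rewrite co_mk => /(congr1 (fun i => i%:R : R)).
rewrite natrD !natrM m0 mulr0 addrC => /eqP; rewrite addr_eq0 => /eqP ak.
by apply/unitrPr; exists (- a%:R); rewrite mulrN mulrC ak opprK.
Qed.

Lemma coprime_prime_lt (p k : nat) : prime p -> (0 < k < p)%N -> coprime p k.
Proof. by move=> p_pr ?; rewrite prime_coprime // gtnNdvd //; lia. Qed.

Lemma natr_neq0_lt (F : fieldType) (p k : nat) :
  prime p -> p%:R = 0 :> F -> (0 < k < p)%N -> k%:R != 0 :> F.
Proof.
move=> p_pr p0 lt_kp; rewrite -unitfE.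
by apply: natr_unit p0 (prime_gt0 p_pr) (coprime_prime_lt p_pr lt_kp).
Qed.

(** Upper negation C(r+i, i) = (-1)^i C(-r-1, i), where -r-1 may be replaced by p-r-1 because i! is
    invertible for i < p. *)
Lemma bin_reflect (F : fieldType) (p r i : nat) :
  prime p -> p%:R = 0 :> F -> (r < p)%N -> (i < p)%N ->
  'C(r + i, i)%:R = (-1) ^+ i * 'C(p - r.+1, i)%:R :> F.
Proof.
move=> p_pr p0 lt_rp; elim: i => [|i IH] lt_ip; first by rewrite !bin0 mulr1.
have i_neq0 := natr_neq0_lt p_pr p0 (lt_ip : 0 < i.+1 < p)%N.
apply: (mulfI i_neq0).
rewrite addnS -natrM -mul_bin_diag natrM IH; last by lia.
rewrite [RHS]mulrCA mul_bin_leftr natrB // p0 exprS.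
by rewrite -addnS natrD; ring.
Qed.

Lemma bin_pred_prime (F : fieldType) (p i : nat) :
  prime p -> p%:R = 0 :> F -> (i < p)%N -> 'C(p.-1, i)%:R = (-1) ^+ i :> F.
Proof.
move=> p_pr p0 lt_ip; have := bin_reflect p_pr p0 (prime_gt0 p_pr) lt_ip.
rewrite add0n binn subn1 => e.
by rewrite -[RHS]mulr1 [X in _ * X](e : 1 = _) mulrA -expr2 sqrr_sign mul1r.
Qed.

Lemma bin_add_prime (F : fieldType) (p i : nat) :
  prime p -> p%:R = 0 :> F -> (i < p)%N -> 'C(p + i, i)%:R = 1 :> F.
Proof.
move=> p_pr p0; elim: i => [|i IH] lt_ip; first by rewrite bin0.
have i_neq0 := natr_neq0_lt p_pr p0 (lt_ip : 0 < i.+1 < p)%N.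
apply: (mulfI i_neq0); rewrite addnS -natrM -mul_bin_diag natrM IH; last by lia.
by rewrite -addnS natrD p0 add0r.
Qed.

(** * Reflection of a(n) modulo p *)

(** With the negative term moved across, the recurrence is an identity in [nat] and so holds in
    every ring. *)
Lemma honeycomb_rec_natr (R : pzRingType) (n : nat) :
  n.+2%:R ^+ 2 * (honeycomb n.+2)%:R + 9%:R * n.+1%:R ^+ 2 * (honeycomb n)%:R =
  (10%:R * n.+1%:R ^+ 2 + 10%:R * n.+1%:R + 3%:R) * (honeycomb n.+1)%:R :> R.
Proof.
have e : (n.+2 ^ 2 * honeycomb n.+2 + 9 * n.+1 ^ 2 * honeycomb n =
    (10 * n.+1 ^ 2 + 10 * n.+1 + 3) * honeycomb n.+1)%N.
  apply/eqP; rewrite -(eqr_nat rat) !(natrD, natrM, natrX); apply/eqP.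
  by rewrite honeycomb_rec subrK.
have := congr1 (fun i => i%:R : R) e.
by rewrite !(natrD, natrM, natrX).
Qed.

Lemma honeycomb_rec_at (R : pzRingType) (k m n : nat) : m = k.+1 -> n = m.+1 ->
  n%:R ^+ 2 * (honeycomb n)%:R + 9%:R * m%:R ^+ 2 * (honeycomb k)%:R =
  (10%:R * m%:R ^+ 2 + 10%:R * m%:R + 3%:R) * (honeycomb m)%:R :> R.
Proof. by move=> -> ->; apply: honeycomb_rec_natr. Qed.

(** The coefficient 10m^2 + 10m + 3 is invariant under m -> -1-m, so modulo p the sequence 9^k
    a(p-1-k) obeys the recurrence of a(k), whose leading coefficient is invertible in this range. *)
Lemma honeycomb_reflect (F : fieldType) (p k : nat) :
  prime p -> (2 < p)%N -> p%:R = 0 :> F -> (k < p)%N ->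
  9%:R ^+ k * (honeycomb (p - k.+1))%:R = (honeycomb p.-1)%:R * (honeycomb k)%:R :> F.
Proof.
move=> p_pr p_gt2 p0.
have lt_k i : (i.+1 < p)%N -> i.+1%:R != 0 :> F.
  by move=> lt_ip; apply: (natr_neq0_lt p_pr p0).
suff [] : ((k < p)%N ->
    9%:R ^+ k * (honeycomb (p - k.+1))%:R = (honeycomb p.-1)%:R * (honeycomb k)%:R :> F) /\
   ((k.+1 < p)%N ->
    9%:R ^+ k.+1 * (honeycomb (p - k.+2))%:R = (honeycomb p.-1)%:R * (honeycomb k.+1)%:R :> F) by [].
elim: k => [|k [IH0 IH1]].
  split=> _; first by rewrite expr0 mul1r subn1 honeycomb0 mulr1.
  (* The second initial value comes from the recurrence that ends at index [p], where the factor p^2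
     removes a(p). *)
  have e1 : p.-1 = (p - 2).+1 by lia.
  have e2 : p = p.-1.+1 by lia.
  have := honeycomb_rec_at F e1 e2.
  have -> : p.-1%:R = -1 :> F by rewrite -subn1 natrB ?prime_gt0 // p0 sub0r.
  rewrite p0 honeycomb1 expr1 => e.
  by transitivity (0 ^+ 2 * (honeycomb p)%:R
    + 9%:R * (-1) ^+ 2 * (honeycomb (p - 2))%:R : F); [ring | rewrite e; ring].
split=> // lt_kp.
have k2 := lt_k _ lt_kp.
have e1 : (p - k.+2 = (p - k.+3).+1)%N by lia.
have e2 : (p - k.+1 = (p - k.+2).+1)%N by lia.
have := honeycomb_rec_at F e1 e2.
have nat_sub i : (i <= p)%N -> (p - i)%:R = - i%:R :> F.
  by move=> le_ip; rewrite natrB // p0 sub0r.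
rewrite !nat_sub; try lia.
move=> e.
apply: (mulfI (expf_neq0 2 k2)).
have {}IH0 := IH0 (ltnW (ltnW lt_kp)).
have {}IH1 := IH1 (ltnW lt_kp).
have e' := honeycomb_rec_natr F k; rewrite -(nat1r k.+1) in k2 e e' *.
rewrite !(exprS 9%:R) in IH1 *.
move: IH0 IH1 e e'.
move: (9%:R : F) (10%:R : F) => n9 n10; move: (n9 ^+ k) => t.
rewrite ?mulNrn; move: (k.+1%:R : F) ((honeycomb p.-1)%:R : F) => m l.
move: ((honeycomb (p - k.+1))%:R : F) ((honeycomb (p - k.+2))%:R : F)
  ((honeycomb (p - k.+3))%:R : F) => d0 d1 d2.
move: ((honeycomb k)%:R : F) ((honeycomb k.+1)%:R : F) ((honeycomb k.+2)%:R : F)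
  => a0 a1 a2 IH0 IH1 e e'.
transitivity (n9 * t * ((n10 * (- (1 + m)) ^+ 2 + n10 * (- (1 + m)) + 3%:R) * d1)
  - n9 * m ^+ 2 * (t * d0)).
   by rewrite -e; ring.
rewrite IH0 mulrCA IH1.
transitivity (l * ((n10 * m ^+ 2 + n10 * m + 3%:R) * a1 - n9 * m ^+ 2 * a0)); first by ring.
by rewrite -e'; ring.
Qed.

(** * Vanishing of the sum of a(m)/m modulo p *)

Lemma prime_dvd_fact (p k : nat) : prime p -> (p %| k`!)%N = (p <= k)%N.
Proof.
move=> p_pr; elim: k => [|k IH]; first by rewrite fact0 dvdn1 leqn0; case: p p_pr => [|[]].
rewrite factS Euclid_dvdM // IH [RHS]leq_eqVlt ltnS; apply/orP/orP=> -[].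
- by move/dvdn_leq => /(_ isT); rewrite leq_eqVlt ltnS => /orP.
- by right.
- by move/eqP=> ->; left.
- by right.
Qed.

Lemma prime_dvd_bin_carry (p n k : nat) :
  prime p -> (k <= n)%N -> (k < p)%N -> (n - k < p)%N -> (p <= n)%N -> (p %| 'C(n, k))%N.
Proof.
move=> p_pr le_kn lt_kp lt_nkp le_pn.
have ndvd i : (i < p)%N -> (p %| i`!)%N = false.
  by move=> lt_ip; rewrite prime_dvd_fact // leqNgt lt_ip.
have : (p %| n`!)%N by rewrite prime_dvd_fact.
rewrite -(bin_fact le_kn) (Euclid_dvdM _ _ p_pr) (Euclid_dvdM k`! _ p_pr).
by rewrite (ndvd k lt_kp) (ndvd _ lt_nkp) !orbF.
Qed.

Lemma sum_inv_prime (F : fieldType) (p : nat) :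
  prime p -> (2 < p)%N -> p%:R = 0 :> F -> \sum_(1 <= m < p) m%:R^-1 = 0 :> F.
Proof.
move=> p_pr p_gt2 p0; set s := LHS.
have two_neq0 : 2%:R != 0 :> F by rewrite (natr_neq0_lt p_pr p0).
have s_opp : s = - s.
  rewrite {1}/s big_nat_rev /= -sumrN; apply: eq_big_nat => m /andP[m_gt0 lt_mp].
  by rewrite add1n subSS natrB ?p0 ?sub0r ?invrN // ltnW.
apply: (mulfI two_neq0); rewrite mulr0 mulr_natl mulr2n {1}s_opp; exact: addNr.
Qed.

(** Put m = i + j. Reflection gives (-1)^i C(p-j-1, i) and (-1)^i C(p-j, i); the signs cancel and
    Vandermonde's identity sums the product. *)
Lemma sum_bin_bin_prime (F : fieldType) (p j : nat) :
  prime p -> p%:R = 0 :> F -> (0 < j < p)%N ->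
  \sum_(1 <= m < p) 'C(m, j)%:R * 'C(m.-1, j.-1)%:R = 'C(2 * (p - j) - 1, p - j)%:R :> F.
Proof.
move=> p_pr p0 /andP[j_gt0 lt_jp].
rewrite (@big_cat_nat _ _ _ j) //=; last by rewrite ltnW.
rewrite [X in X + _]big1_seq ?add0r; last first.
  by move=> m /andP[_]; rewrite mem_index_iota => /andP[_ ?]; rewrite bin_small // mul0r.
rewrite -{1}[j]add0n big_addn.
transitivity (\sum_(0 <= i < p - j) ('C(p - j.+1, i) * 'C(p - j, p - j - i))%N%:R : F).
  apply: eq_big_nat => i /andP[_ lt_i].
  have -> : 'C(i + j, j) = 'C(j + i, i) by rewrite -bin_sub ?leq_addl // addnK addnC.
  have -> : 'C((i + j).-1, j.-1) = 'C(j.-1 + i, i).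
    by rewrite -bin_sub; [congr 'C(_, _); lia | lia].
  rewrite !(bin_reflect p_pr p0); try lia.
  rewrite mulrACA -expr2 sqrr_sign mul1r prednK // natrM bin_sub //.
  by lia.
rewrite -natr_sum; congr (_%:R).
have -> : (2 * (p - j) - 1 = (p - j.+1) + (p - j))%N by lia.
rewrite -binomial.Vandermonde big_mkord big_ord_recr /= bin_small ?mul0n ?addn0 //.
by lia.
Qed.

(** After the exchange of sums each column [j] vanishes. For j > 0, C(m, j)/m = C(m-1, j-1)/j gives
    C(2j, j) C(2(p-j)-1, p-j) / j, and p divides the first binomial if 2j >= p and the second
    otherwise. *)
Lemma sum_honeycomb_div_prime (F : fieldType) (p : nat) :
  prime p -> (2 < p)%N -> p%:R = 0 :> F ->
  \sum_(1 <= m < p) (honeycomb m)%:R / m%:R = 0 :> F.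
Proof.
move=> p_pr p_gt2 p0.
transitivity (\sum_(1 <= m < p) \sum_(0 <= j < p) ('C(m, j) ^ 2 * 'C(2 * j, j))%N%:R / m%:R : F).
  apply: eq_big_nat => m /andP[m_gt0 lt_mp].
  rewrite (@honeycomb_widen _ m p.-1); last by lia.
  by rewrite prednK ?prime_gt0 // mulr_suml.
rewrite exchange_big big1_seq // => j /andP[_]; rewrite mem_index_iota => /andP[_ lt_jp].
have [->|j_gt0] := posnP j.
  by rewrite -[RHS](sum_inv_prime p_pr p_gt2 p0); apply: eq_bigr => m _; rewrite !bin0 mul1r.
have j_neq0 : j%:R != 0 :> F by rewrite (natr_neq0_lt p_pr p0) // j_gt0.
transitivity ('C(2 * j, j)%:R / j%:R * \sum_(1 <= m < p) 'C(m, j)%:R * 'C(m.-1, j.-1)%:R : F).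
  rewrite mulr_sumr; apply: eq_big_nat => m lt_mp.
  have m_neq0 : m%:R != 0 :> F by rewrite (natr_neq0_lt p_pr p0).
  have e : m%:R * 'C(m.-1, j.-1)%:R = j%:R * 'C(m, j)%:R :> F.
    by rewrite -!natrM mul_bin_diag prednK // prednK //; case/andP: lt_mp.
  have -> : 'C(m.-1, j.-1)%:R = j%:R / m%:R * 'C(m, j)%:R :> F.
    by apply: (mulfI m_neq0); rewrite e; field.
  by rewrite natrM natrX; field; rewrite ?j_neq0 ?m_neq0.
rewrite (sum_bin_bin_prime p_pr p0) ?j_gt0 //.
suff : (p %| 'C(2 * j, j) * 'C(2 * (p - j) - 1, p - j))%N.
  case/dvdnP=> q /(congr1 (fun i => i%:R : F)); rewrite !natrM p0 mulr0 => e.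
  by rewrite mulrAC e mul0r.
have [lt_2jp|le_p2j] := ltnP (2 * j) p.
  by apply/dvdn_mull/prime_dvd_bin_carry => //; lia.
by apply/dvdn_mulr/prime_dvd_bin_carry => //; lia.
Qed.

(** * The terms k < p - 1 modulo p^2 *)

(** Multiplication by 9^(p-1) makes the terms integers. *)
Lemma honeycomb_sum_dvd (p : nat) : prime p -> (4 < p)%N ->
  ((p ^ 2)%N%:Z %| \sum_(0 <= k < p.-1) (-1) ^+ k * 9%:R ^+ (p.-1 - k)
     * (honeycomb k * 'C(p, k.+1) * 'C(p + k, k))%N%:R)%Z.
Proof.
move=> p_pr p_gt4.
pose c k := ('C(p, k.+1) %/ p)%N.
have cE k : (k < p.-1)%N -> 'C(p, k.+1) = (p * c k)%N.
  by move=> lt_kp; rewrite /c mulnC divnK // prime_dvd_bin //; lia.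
pose s : int := \sum_(0 <= k < p.-1) (-1) ^+ k * 9%:R ^+ (p.-1 - k)
     * (honeycomb k * c k * 'C(p + k, k))%N%:R.
rewrite (_ : \sum_(0 <= k < p.-1) _ = p%:Z * s); last first.
  rewrite mulr_sumr; apply: eq_big_nat => k /andP[_ lt_k].
  by rewrite cE // !natrM -(natz p); ring.
rewrite -mulnn PoszM dvdz_mul2l; last by lia.
pose F := 'F_p; have p0 : p%:R = 0 :> F by apply: pchar_Fp_0.
suff s0 : s%:~R = 0 :> F.
  rewrite dvdzE /= (dvdn_pcharf (pchar_Fp p_pr)).
  have := s0; rewrite {1}[s]intEsign rmorphM rmorph_sign /= => /eqP.
  by rewrite mulf_eq0 signr_eq0.
have -> : s%:~R = - (honeycomb p.-1)%:R * \sum_(1 <= m < p) (honeycomb m)%:R / m%:R :> F.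
  rewrite /s rmorph_sum /= [in RHS]big_nat_rev /= [in RHS]big_add1 mulr_sumr.
  apply: eq_big_nat => k /andP[_ lt_k].
  rewrite (_ : 1 + p - k.+2 = p - k.+1)%N; last by lia.
  have k_neq0 : k.+1%:R != 0 :> F by rewrite (natr_neq0_lt p_pr p0); lia.
  (* C(p, k+1)/p = C(p-1, k)/(k+1), and C(p-1, k) is (-1)^k modulo p. *)
  have cF : (c k)%:R = (-1) ^+ k / k.+1%:R :> F.
    have ck : (k.+1 * c k = 'C(p.-1, k))%N.
      apply/eqP; rewrite -(eqn_pmul2l (prime_gt0 p_pr)) mulnCA -cE //.
      by rewrite mul_bin_diag.
    apply: (mulfI k_neq0); rewrite -natrM ck (bin_pred_prime p_pr p0); last by lia.
    by rewrite mulrC divfK.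
  have lt_kp : (p - k.+1 < p)%N by lia.
  have := honeycomb_reflect p_pr (ltnW (ltnW p_gt4)) p0 lt_kp.
  rewrite (_ : p - (p - k.+1).+1 = k)%N; last by lia.
  rewrite (_ : p.-1 - k = p - k.+1)%N; last by lia.
  rewrite !rmorphM rmorph_sign rmorphXn /=  !mulrz_nat cF bin_add_prime //; last by lia.
  rewrite natrB ?p0; last by lia.
  move=> e; transitivity ((-1) ^+ k ^+ 2 * (9%:R ^+ (p - k.+1) * (honeycomb k)%:R) / k.+1%:R : F).
    by ring.
  by rewrite e sqrr_sign sub0r invrN; ring.
by rewrite (sum_honeycomb_div_prime p_pr) ?mulr0 //; lia.
Qed.

(** * Sequences of period 3 and division by 1 + x + x^2 *)

(* The Legendre symbol [(n/3)], and the sum [w^n + w^-n] for a primitive cube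
   root of unity [w]. *)
Definition chi3 (R : pzRingType) (n : nat) : R := [:: 0; 1; -1]`_(n %% 3).
Definition tr3 (R : pzRingType) (n : nat) : R := [:: 2%:R; -1; -1]`_(n %% 3).

Lemma chi3E (R : pzRingType) q n : chi3 R (3 * q + n) = chi3 R n.
Proof. by rewrite /chi3 mulnC modnMDl. Qed.

Lemma tr3E (R : pzRingType) q n : tr3 R (3 * q + n) = tr3 R n.
Proof. by rewrite /tr3 mulnC modnMDl. Qed.

Lemma mod3P (n : nat) : exists q r : nat, n = (3 * q + r)%N /\ (r < 3)%N.
Proof.
by exists (n %/ 3)%N, (n %% 3)%N; rewrite mulnC -divn_eq ltn_mod.
Qed.

Lemma chi3_rec (R : pzRingType) n : chi3 R n.+2 = - chi3 R n.+1 - chi3 R n.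
Proof.
have [q [r [-> r_lt3]]] := mod3P n; rewrite -!addnS !chi3E.
case: r r_lt3 => [|[|[|//]]] _; rewrite /chi3 /=.
- by rewrite subr0.
- by rewrite opprK subrr.
- by rewrite oppr0 sub0r opprK.
Qed.

Lemma tr3_rec (R : pzRingType) n : tr3 R n.+2 = - tr3 R n.+1 - tr3 R n.
Proof.
have [q [r [-> r_lt3]]] := mod3P n; rewrite -!addnS !tr3E.
case: r r_lt3 => [|[|[|//]]] _; rewrite /tr3 /=.
- by rewrite opprK [2%:R]mulr2n opprD addrA subrr sub0r.
- by rewrite !opprK -mulr2n.
- by rewrite opprK [2%:R]mulr2n opprD -addrA addNr addr0.
Qed.

(** [chi3] is proportional to w^q - w^-q, so the product is chi3(q+m) + chi3(q-m); modulo 3, [2 * m]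
    stands for -m. *)
Lemma chi3D (R : comNzRingType) m q : tr3 R m * chi3 R q = chi3 R (m + q) + chi3 R (2 * m + q).
Proof.
elim/ltn_ind: m => -[|[|m]] IH.
- by rewrite /tr3 muln0 !add0n /=; ring.
- by rewrite /tr3 /= !addSn add0n (chi3_rec _ q); ring.
rewrite tr3_rec mulrDl !mulNr !IH //.
rewrite (_ : 2 * m.+2 + q = (2 * m + q).+4)%N; last by lia.
rewrite (_ : 2 * m.+1 + q = (2 * m + q).+2)%N; last by lia.
by rewrite addSn addSn (chi3_rec _ (m + q)) !(chi3_rec _ (2 * m + q)); ring.
Qed.

Lemma chi3_2n (R : pzRingType) n : chi3 R (2 * n) = - chi3 R n.
Proof.
have [q [r [-> r_lt3]]] := mod3P n.
rewrite mulnDr mulnCA !chi3E.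
by case: r r_lt3 => [|[|[|//]]] _; rewrite /chi3 /= ?oppr0 ?opprK.
Qed.

Lemma chi3_sqr (R : pzRingType) p : prime p -> (3 < p)%N -> chi3 R p ^+ 2 = 1.
Proof.
move=> p_pr p_gt3; have [q [r [e r_lt3]]] := mod3P p.
rewrite e chi3E; case: r r_lt3 e => [|[|[|//]]] _ e; rewrite /chi3 /=.
- have : (3 %| p)%N by rewrite e addn0 dvdn_mulr.
  by rewrite dvdn_prime2 // => /eqP; lia.
- by rewrite expr1n.
- by rewrite sqrrN expr1n.
Qed.

(* Solves [a * (1 + x + x^2) = g] for power series, as [1/(1 + x + x^2)] has
   coefficients [chi3 (m + 1)]. *)
Lemma chi3_convolution (R : comNzRingType) (a g : nat -> R) N :
  g 0%N = a 0%N -> g 1%N = a 1%N + a 0%N ->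
  (forall m, (m.+2 <= N)%N -> g m.+2 = a m.+2 + a m.+1 + a m) ->
  (0 < N)%N ->
  forall m, (m <= N)%N -> a m = \sum_(0 <= k < m.+1) g k * chi3 R (m.+1 - k).
Proof.
move=> g0 g1 gS N_gt0 m.
suff [] : ((m <= N)%N -> a m = \sum_(0 <= k < m.+1) g k * chi3 R (m.+1 - k)) /\
  ((m < N)%N -> a m.+1 = \sum_(0 <= k < m.+2) g k * chi3 R (m.+2 - k)) by [].
elim: m => [|m [IH0 IH1]].
  split=> _; first by rewrite big_nat1 g0 mulr1.
  by rewrite !big_nat_recr // big_nil g0 g1 /chi3 /=; ring.
split=> // lt_mN.
have := gS m lt_mN; rewrite IH0 ?IH1; try lia.
move/eqP; rewrite -addrA -subr_eq => /eqP <-.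
rewrite !(big_nat_recr m.+2) ?(big_nat_recr m.+1) //=.
rewrite !subSnn (_ : m.+3 - m.+1 = 2)%N; last by lia.
have -> : \sum_(0 <= k < m.+1) g k * chi3 R (m.+3 - k) =
   - \sum_(0 <= k < m.+1) g k * chi3 R (m.+2 - k) - \sum_(0 <= k < m.+1) g k * chi3 R (m.+1 - k).
  rewrite -sumrN -sumrB; apply: eq_big_nat => k /andP[_ lt_k].
  rewrite !(@subSn k); try lia.
  by rewrite chi3_rec; ring.
by rewrite /chi3 /=; ring.
Qed.

(** * Binomial sums of sequences with f(k+2) + f(k+1) + f(k) = 0 *)

(** With E the shift, the sum is (1 + yE)^(n+1) f at 0; Pascal's rule splits off one factor. *)
Lemma bin_sum_step (R : comNzRingType) (y : R) (f : nat -> R) n :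
  \sum_(0 <= k < n.+2) y ^+ k * 'C(n.+1, k)%:R * f k =
  \sum_(0 <= k < n.+1) y ^+ k * 'C(n, k)%:R * f k
   + y * \sum_(0 <= k < n.+1) y ^+ k * 'C(n, k)%:R * f k.+1.
Proof.
rewrite big_nat_recl // [X in X + _ * _]big_nat_recl //.
rewrite !bin0 -addrA; congr (_ + _).
have -> : \sum_(0 <= k < n) y ^+ k.+1 * 'C(n, k.+1)%:R * f k.+1 =
   \sum_(0 <= k < n.+1) y ^+ k.+1 * 'C(n, k.+1)%:R * f k.+1.
  by rewrite big_nat_recr //= bin_small // mulr0 mul0r addr0.
rewrite mulr_sumr -big_split; apply: eq_bigr => k _ /=.
by rewrite binS natrD exprS; ring.
Qed.

(** Here E^2 + E + 1 = 0, hence 1 + E = -E^2. *)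
Lemma bin_sum_period3 (R : comNzRingType) (f : nat -> R) n :
  (forall k, f k.+2 = - f k.+1 - f k) ->
  \sum_(0 <= k < n.+1) 'C(n, k)%:R * f k = (-1) ^+ n * f (2 * n)%N.
Proof.
move=> fS.
transitivity (\sum_(0 <= k < n.+1) 1 ^+ k * 'C(n, k)%:R * f k).
  by apply: eq_bigr => k _; rewrite expr1n mul1r.
elim: n f fS => [|n IH] f fS; first by rewrite big_nat1 !mul1r.
rewrite bin_sum_step IH // IH // mul1r (_ : 2 * n.+1 = (2 * n).+2)%N; last by lia.
by rewrite fS exprS; ring.
Qed.

(** Here (1 - E)^2 = -3E. *)
Lemma alt_bin_sum_period3 (R : comNzRingType) (f : nat -> R) h :
  (forall k, f k.+2 = - f k.+1 - f k) ->
  \sum_(0 <= k < (2 * h).+1) (-1) ^+ k * 'C(2 * h, k)%:R * f k = (-3%:R) ^+ h * f h.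
Proof.
elim: h f => [|h IH] f fS; first by rewrite big_nat1 !mul1r.
rewrite (_ : 2 * h.+1 = (2 * h).+2)%N; last by lia.
rewrite !bin_sum_step (IH f) // (IH (fun k => f k.+1)) // (IH (fun k => f k.+2)) // fS exprS.
by ring.
Qed.

Lemma alt_bin_sum_period3_odd (R : comNzRingType) (f : nat -> R) h :
  (forall k, f k.+2 = - f k.+1 - f k) ->
  \sum_(0 <= k < (2 * h).+2) (-1) ^+ k * 'C((2 * h).+1, k)%:R * f k = (-3%:R) ^+ h * (f h - f h.+1).
Proof.
move=> fS; rewrite bin_sum_step alt_bin_sum_period3 //
  (@alt_bin_sum_period3 _ (fun k => f k.+1)) //.
by ring.
Qed.

Lemma alt_bin_sum (R : comNzRingType) n :
  \sum_(0 <= k < n.+2) (-1) ^+ k * 'C(n.+1, k)%:R = 0 :> R.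
Proof.
transitivity (\sum_(0 <= k < n.+2) (-1) ^+ k * 'C(n.+1, k)%:R * (fun=> 1) k : R).
  by apply: eq_bigr => k _; rewrite mulr1.
by rewrite bin_sum_step mulN1r subrr.
Qed.

(** * Central binomial sums as polynomial coefficients *)

Lemma coef_chi3 (R : comNzRingType) (A : {poly R}) m :
  A`_m = \sum_(0 <= k < m.+1) ((1 + 'X + 'X^2) * A)`_k * chi3 R (m.+1 - k).
Proof.
apply: (@chi3_convolution _ (fun k => A`_k) _ m.+1) => // [||k _].
- by rewrite !mulrDl mul1r !coefD coefXM coefXnM /= !addr0.
- by rewrite !mulrDl mul1r !coefD coefXM coefXnM /= !addr0.
- by rewrite !mulrDl mul1r !coefD coefXM coefXnM /= subn2.
Qed.

Lemma coef_X1n (R : comNzRingType) n k : (('X + 1 : {poly R}) ^+ n)`_k = 'C(n, k)%:R.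
Proof.
elim: n k => [|n IH] k; first by rewrite expr0 coef1 bin0n.
rewrite exprS mulrDl mul1r coefD coefXM !IH.
by case: k => [|k]; rewrite ?bin0 ?add0r // binS natrD addrC.
Qed.

(** The geometric sum [A] of x and (1+x)^2 has the left-hand side as its top central coefficient.
    Since (1+x)^2 - x = 1 + x + x^2, its product with this trinomial is a difference of two powers,
    and the power of x lies above the degrees involved. *)
Lemma central_bin_sum (R : comNzRingType) n :
  \sum_(0 <= j < n) 'C(2 * j, j)%:R = \sum_(0 <= k < n) 'C(2 * n, k)%:R * chi3 R (n - k) :> R.
Proof.
case: n => [|n]; first by rewrite !big_nil.
pose A : {poly R} := \sum_(i < n.+1) 'X ^+ (n.+1.-1 - i) * (('X + 1) ^+ 2) ^+ i.
have AE : (1 + 'X + 'X^2) * A = ('X + 1) ^+ (2 * n.+1) - 'X ^+ n.+1.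
  transitivity (- (('X - ('X + 1) ^+ 2) * A)); first by ring.
  by rewrite -subrXX opprB -exprM.
transitivity (A`_n).
  rewrite /A coef_sum big_mkord; apply: eq_bigr => i _.
  rewrite coefXnM -exprM coef_X1n /=.
  by case: ltnP => [|_]; [lia | rewrite subKn // -ltnS].
rewrite coef_chi3 AE; apply: eq_big_nat => k /andP[_ lt_kn].
by rewrite coefB coef_X1n coefXn ltn_eqF // subr0.
Qed.

(** * Binomial coefficients in rings where p^2 = 0 *)

Lemma prime_bin_mulr (R : comNzRingType) p k :
  prime p -> (0 < k < p)%N -> exists x : R, 'C(p, k)%:R = p%:R * x.
Proof.
move=> p_pr lt_kp; have /dvdnP[q ->] := prime_dvd_bin p_pr lt_kp.
by exists q%:R; rewrite natrM mulrC.
Qed.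

Lemma prime_bin_mul0 (R : comNzRingType) p k l :
  prime p -> (p ^ 2)%:R = 0 :> R -> (0 < k < p)%N -> (0 < l < p)%N ->
  'C(p, k)%:R * 'C(p, l)%:R = 0 :> R.
Proof.
rewrite natrX => p_pr p2 lt_kp lt_lp.
have [[x ->] [y ->]] := (prime_bin_mulr R p_pr lt_kp, prime_bin_mulr R p_pr lt_lp).
by rewrite mulrACA -expr2 p2 mul0r.
Qed.

(** In Vandermonde's sum for C(p+p, k) every inner product is a multiple of p^2; the two end terms
    remain. *)
Lemma bin_2p (R : comNzRingType) p k :
  prime p -> (p ^ 2)%:R = 0 :> R -> (0 < k <= p)%N ->
  'C(2 * p, k)%:R = 2%:R * 'C(p, k)%:R :> R.
Proof.
move=> p_pr p2; case: k => // k /andP[_ lt_kp].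
rewrite mul2n -addnn -binomial.Vandermonde natr_sum big_ord_recl big_ord_recr /=.
rewrite !bin0 subn0 subnn bin0 mul1n muln1 big1 ?add0r -?mulr2n ?mulr_natl // => i _.
by rewrite natrM prime_bin_mul0 //= /bump /=; have := ltn_ord i; lia.
Qed.

Lemma unit2_mod_prime_sqr (R : comUnitRingType) p :
  prime p -> (2 < p)%N -> (p ^ 2)%:R = 0 :> R -> 2%:R \is a @GRing.unit R.
Proof.
move=> p_pr p_gt2 p2; apply: (natr_unit p2); first by rewrite expn_gt0 prime_gt0.
by rewrite coprimeXl // coprime_prime_lt.
Qed.

Lemma bin_2p_pred (R : comUnitRingType) p :
  prime p -> (2 < p)%N -> (p ^ 2)%:R = 0 :> R -> 'C(p + p.-1, p.-1)%:R = 1 :> R.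
Proof.
move=> p_pr p_gt2 p2.
have u2 := unit2_mod_prime_sqr p_pr p_gt2 p2.
have p_gt0 := prime_gt0 p_pr.
have e : (2 * 'C(p + p.-1, p.-1) = 'C(2 * p, p))%N.
  apply/eqP; rewrite -(eqn_pmul2l p_gt0) mulnA (mulnC p 2).
  have := mul_bin_diag (2 * p) p.-1; rewrite prednK // => <-.
  by rewrite (_ : (2 * p).-1 = p + p.-1)%N //; lia.
apply: (mulrI u2); rewrite -natrM e bin_2p ?p_gt0 ?leqnn //.
by rewrite binn.
Qed.

(** The terms 0 < k < p are twice those of the row C(p, k). That whole row sums to [chi3 R p], which
    is already its term at 0, so they cancel. *)
Lemma central_bin_sum_prime (R : comNzRingType) p :
  prime p -> (2 < p)%N -> (p ^ 2)%:R = 0 :> R ->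
  \sum_(0 <= j < p) 'C(2 * j, j)%:R = chi3 R p.
Proof.
move=> p_pr p_gt2 p2; have p_gt0 := prime_gt0 p_pr.
have odd_p : odd p by case/even_prime: p_pr p_gt2 => ->.
rewrite central_bin_sum big_ltn // bin0 subn0 mul1r.
have -> : \sum_(1 <= k < p) 'C(2 * p, k)%:R * chi3 R (p - k) =
    2%:R * \sum_(1 <= k < p) 'C(p, k)%:R * chi3 R (p - k).
  by rewrite mulr_sumr; apply: eq_big_nat => k lt_k; rewrite bin_2p // ?mulrA //; lia.
have full : \sum_(0 <= k < p.+1) 'C(p, k)%:R * chi3 R (p - k) = chi3 R p.
  transitivity (\sum_(0 <= k < p.+1) 'C(p, k)%:R * chi3 R k).
    rewrite big_nat_rev /=; apply: eq_big_nat => k /andP[_ lt_kp].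
    by rewrite add0n subSS bin_sub // subKn.
  rewrite bin_sum_period3; last exact: chi3_rec.
  by rewrite chi3_2n -signr_odd odd_p expr1 mulN1r opprK.
move: full; rewrite big_nat_recr //= big_ltn // bin0 subn0 subnn mulr0 addr0 mul1r.
by move/eqP; rewrite -subr_eq0 addrAC subrr add0r => /eqP ->; rewrite mulr0 addr0.
Qed.

(** * Coefficients of (1 + x + x^2)^p modulo p^2 *)

Lemma trinomial_ode_coef (R : comNzRingType) (c : R) (W : {poly R}) :
  (1 + 'X + 'X^2) * W^`() = c *: ((1 + 2%:R *: 'X) * W) ->
  [/\ W`_1 = c * W`_0, 2%:R * W`_2 = c * (W`_1 + 2%:R * W`_0) - W`_1 &
   forall k, k.+3%:R * W`_k.+3 =
     c * (W`_k.+2 + 2%:R * W`_k.+1) - k.+2%:R * W`_k.+2 - k.+1%:R * W`_k.+1].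
Proof.
move=> ode; rewrite !mulrDl !mul1r -scalerAl in ode.
split=> [||k].
- have := congr1 (fun q : {poly R} => q`_0) ode.
  by rewrite !(coefD, coefZ, coefXM, coefXnM, coef_deriv) /= mulr0 !addr0.
- have := congr1 (fun q : {poly R} => q`_1) ode.
  rewrite !(coefD, coefZ, coefXM, coefXnM, coef_deriv) /= .
  by move=> <-; ring.
have := congr1 (fun q : {poly R} => q`_k.+2) ode.
rewrite !(coefD, coefZ, coefXM, coefXnM, coef_deriv) /= subn2 /= => <-.
by ring.
Qed.

(** Below degree p the power is 1 + p log(1 + x + x^2) modulo p^2, and the logarithm has
    coefficients -tr3(m)/m. Similarly C(p, m) is (-1)^(m-1) p/m. The differential equation of the
    power replaces the logarithm. *)
Lemma trinomial_coef_prime (R : comUnitRingType) p m :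
  prime p -> (2 < p)%N -> (p ^ 2)%:R = 0 :> R -> (0 < m < p)%N ->
  ((1 + 'X + 'X^2 : {poly R}) ^+ p)`_m = (-1) ^+ m * 'C(p, m)%:R * tr3 R m.
Proof.
move=> p_pr p_gt2 p2; have p_gt0 := prime_gt0 p_pr.
have P2 : p%:R ^+ 2 = 0 :> R by rewrite -natrX.
set w : {poly R} := 1 + 'X + 'X^2; pose g k := (w ^+ p)`_k.
have unit_lt k : (0 < k < p)%N -> k%:R \is a @GRing.unit R.
  move=> lt_k; apply: (natr_unit p2); first by rewrite expn_gt0 p_gt0.
  by rewrite coprimeXl // coprime_prime_lt.
have g0 : g 0%N = 1.
  by rewrite /g -horner_coef0 horner_exp /w !(hornerD, hornerC, hornerX, hornerXn)
    expr0n !addr0 expr1n.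
have ode : w * (w ^+ p)^`() = p%:R *: ((1 + 2%:R *: 'X) * w ^+ p).
  have -> : w ^+ p = w * w ^+ p.-1 by rewrite -exprS prednK.
  have -> : (w * w ^+ p.-1)^`() = w^`() * w ^+ p.-1 *+ p by rewrite -exprS prednK // deriv_exp.
  rewrite (_ : w^`() = 1 + 2%:R *: 'X); last by rewrite /w !derivE add0r scaler_nat.
  by rewrite -scaler_nat -scalerAr mulrCA.
have [g1 g2 g_rec] := trinomial_ode_coef ode.
rewrite -/(g _) -/(g _) g0 mulr1 in g1.
have {}g2 : 2%:R * g 2 = p%:R * (g 1%N + 2%:R) - g 1%N.
  by rewrite /g g2 -/(g 0) g0 mulr1.
have {}g_rec k : (k.+3)%:R * g k.+3 =
    p%:R * (g k.+2 + 2%:R * g k.+1) - k.+2%:R * g k.+2 - k.+1%:R * g k.+1.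
  exact: g_rec.
(* A coefficient that is a multiple of p drops out of the terms of the recurrence that carry the
   factor p. *)
have Pg0 k : (0 < k < p)%N -> k%:R * g k = - (p%:R * tr3 R k) -> p%:R * g k = 0.
  move=> lt_k e; apply: (mulrI (unit_lt k lt_k)).
  by rewrite mulrCA e mulrN mulrA -expr2 P2 mul0r oppr0 mulr0.
have gE k : (0 < k < p)%N -> k%:R * g k = - (p%:R * tr3 R k).
  elim/ltn_ind: k => -[|[|[|k]]] IH lt_kp //.
  - by rewrite g1 /tr3 /=; ring.
  - by rewrite g2 g1 mulrDr -expr2 P2 /tr3 /=; ring.
  have e2 := IH k.+2 (ltnSn _) (ltnW lt_kp).
  have e1 := IH k.+1 (ltnW (ltnSn _)) (ltnW (ltnW lt_kp)).
  rewrite g_rec e2 e1 mulrDr (Pg0 k.+2 (ltnW lt_kp) e2) mulrCA (Pg0 k.+1 (ltnW (ltnW lt_kp)) e1).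
  by rewrite tr3_rec; ring.
move=> lt_m; apply: (mulrI (unit_lt m lt_m)).
rewrite -/(g m) gE //.
have binE : m%:R * 'C(p, m)%:R = p%:R * 'C(p.-1, m.-1)%:R :> R.
  by rewrite -!natrM mul_bin_diag prednK //; case/andP: lt_m.
have binP k : (k < p)%N -> p%:R * 'C(p.-1, k)%:R = (-1) ^+ k * p%:R :> R.
  elim: k => [|k IH] lt_k; first by rewrite bin0 mul1r mulr1.
  have := prime_bin_mulr R p_pr (lt_k : 0 < k.+1 < p)%N => -[x].
  rewrite -[in 'C(p, _)](prednK p_gt0) binS natrD => /eqP.
  rewrite eq_sym -subr_eq => /eqP <-.
  rewrite mulrBr IH; last by lia.
  by rewrite mulrA -expr2 P2 exprS; ring.
transitivity ((-1) ^+ m * (m%:R * 'C(p, m)%:R) * tr3 R m); last by ring.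
rewrite binE binP; last by lia.
rewrite mulrA -exprD.
rewrite (_ : m + m.-1 = (2 * m.-1).+1)%N; last by lia.
by rewrite exprS exprM sqrrN !expr1n; ring.
Qed.

(** * The alternating central binomial sum, and a(p-1) modulo p^2 *)

(** Expand (x - (1+x)^2)^n and take the coefficient of x^n. *)
Lemma alt_central_bin_sum (R : comNzRingType) n :
  \sum_(0 <= j < n.+1) (-1) ^+ j * 'C(n, j)%:R * 'C(2 * j, j)%:R =
  (-1) ^+ n * ((1 + 'X + 'X^2 : {poly R}) ^+ n)`_n.
Proof.
have -> : (-1) ^+ n * ((1 + 'X + 'X^2 : {poly R}) ^+ n)`_n =
    (('X - ('X + 1) ^+ 2) ^+ n : {poly R})`_n.
  have -> : 'X - ('X + 1) ^+ 2 = (-1)%:P * (1 + 'X + 'X^2) :> {poly R}.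
    by rewrite polyCN polyC1; ring.
  by rewrite exprMn -polyC_exp coefCM.
rewrite exprDn coef_sum big_mkord; apply: eq_bigr => j _.
rewrite coefMn coefXnM; case: ltnP => [|_]; first by lia.
rewrite subKn; last by rewrite -ltnS.
rewrite (exprNn (('X + 1) ^+ 2)) -exprM -polyC1 -polyCN -polyC_exp coefCM coef_X1n.
by rewrite -mulr_natr; ring.
Qed.

Lemma alt_central_bin_sum_prime (R : comUnitRingType) p h :
  prime p -> (p ^ 2)%:R = 0 :> R -> p = (2 * h).+1 -> (2 < p)%N ->
  \sum_(0 <= j < p) (-1) ^+ j * 'C(p.-1, j)%:R * 'C(2 * j, j)%:R = 2%:R * (-3%:R) ^+ h - chi3 R p.
Proof.
move=> p_pr p2 ph p_gt2; have p_gt0 := prime_gt0 p_pr.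
have p1 : p.-1.+1 = p by rewrite prednK.
have := alt_central_bin_sum R p.-1; rewrite p1 => ->.
rewrite (_ : p.-1 = 2 * h)%N; last by rewrite ph.
rewrite exprM sqrrN !expr1n mul1r coef_chi3 -exprS -ph.
rewrite big_ltn // subn0.
set w := 1 + 'X + 'X^2.
have -> : (w ^+ p)`_0 = 1.
  by rewrite -horner_coef0 horner_exp /w !(hornerD, hornerC, hornerX, hornerXn)
    expr0n !addr0 expr1n.
rewrite mul1r.
have -> : \sum_(1 <= k < p) (w ^+ p)`_k * chi3 R (p - k) =
   \sum_(1 <= k < p) (-1) ^+ k * 'C(p, k)%:R * (chi3 R p + chi3 R (p + k)).
  apply: eq_big_nat => k lt_k; rewrite trinomial_coef_prime // -[LHS]mulrA chi3D.
  by congr (_ * (chi3 _ _ + chi3 _ _)); lia.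
(* The full row adds 2 chi3(p) at k = 0, and at k = p a term that is zero because chi3(2p) =
   -chi3(p). *)
have full : \sum_(0 <= k < p.+1) (-1) ^+ k * 'C(p, k)%:R * (chi3 R p + chi3 R (p + k)) =
    2%:R * (-3%:R) ^+ h.
  transitivity ((\sum_(0 <= k < p.+1) (-1) ^+ k * 'C(p, k)%:R) * chi3 R p
     + \sum_(0 <= k < p.+1) (-1) ^+ k * 'C(p, k)%:R * chi3 R (p + k)).
    by rewrite mulr_suml -big_split; apply: eq_bigr => k _ /=; rewrite mulrDr.
  rewrite {1 2}ph alt_bin_sum mul0r add0r.
  rewrite {1 2}ph (@alt_bin_sum_period3_odd _ (fun k => chi3 R (p + k))); last first.
    by move=> k; rewrite !addnS chi3_rec.
  rewrite (_ : p + h = 3 * h + 1)%N; last by lia.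
  rewrite (_ : p + h.+1 = 3 * h + 2)%N; last by lia.
  by rewrite !chi3E /chi3 /=; ring.
move: full; rewrite big_nat_recr //= big_ltn // bin0 binn !mulr1 mul1r addn0.
rewrite addnn -mul2n chi3_2n subrr mulr0 addr0 => <-.
by ring.
Qed.

Lemma honeycomb_pred_prime (R : comUnitRingType) p :
  prime p -> (3 < p)%N -> (p ^ 2)%:R = 0 :> R ->
  (honeycomb p.-1)%:R = chi3 R p * 9%:R ^+ p.-1.
Proof.
move=> p_pr p_gt3 p2; have p_gt0 := prime_gt0 p_pr; have p_gt2 := ltnW p_gt3.
have P2 : p%:R ^+ 2 = 0 :> R by rewrite -natrX.
have odd_p : odd p by case/even_prime: p_pr p_gt2 => ->.
have [h ph] : exists h, p = (2 * h).+1.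
  by exists p./2; rewrite -[LHS]odd_double_half odd_p mul2n.
have sigE := central_bin_sum_prime p_pr p_gt2 p2.
have tauE := alt_central_bin_sum_prime p_pr p2 ph p_gt2.
have binP j : (j < p)%N -> exists x : R, (-1) ^+ j * 'C(p.-1, j)%:R = 1 + p%:R * x.
  elim: j => [|j IH] lt_j; first by exists 0; rewrite bin0 mulr0 addr0 mulr1.
  have [x e] := IH (ltnW lt_j).
  have [y] := prime_bin_mulr R p_pr (lt_j : 0 < j.+1 < p)%N.
  rewrite -[in 'C(p, _)](prednK p_gt0) binS natrD => /eqP.
  rewrite eq_sym -subr_eq => /eqP <-.
  exists (x + (-1) ^+ j.+1 * y).
  transitivity ((-1) ^+ j.+1 * (p%:R * y) + (-1) ^+ j * 'C(p.-1, j)%:R : R);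
    first by rewrite exprS; ring.
  by rewrite e; ring.
set e := (-3%:R) ^+ h in tauE *; set c := chi3 R p in sigE tauE *.
have domE : (honeycomb p.-1)%:R = 2%:R * (2%:R * e - c) - c.
  rewrite -tauE -sigE mulr_sumr -sumrB (@honeycomb_widen _ p.-1 p.-1) // prednK //.
  apply: eq_big_nat => j /andP[_ lt_j]; rewrite natrM natrX.
  have [x ex] := binP j lt_j.
  have -> : 'C(p.-1, j)%:R ^+ 2 = ((-1) ^+ j * 'C(p.-1, j)%:R) ^+ 2 :> R.
    by rewrite exprMn sqrr_sign mul1r.
  rewrite ex (_ : (1 + p%:R * x) ^+ 2 = 1 + 2%:R * (p%:R * x) + p%:R ^+ 2 * x ^+ 2); last by ring.
  by rewrite P2; ring.
(* Modulo p the signed binomials are 1, so the two central sums agree there and 2(e - c) is a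
   multiple of p. *)
have [y ey] : exists y, 2%:R * e - c = c + p%:R * y.
  rewrite -tauE -sigE.
  have : forall n, (n <= p)%N -> exists y,
     \sum_(0 <= j < n) (-1) ^+ j * 'C(p.-1, j)%:R * 'C(2 * j, j)%:R =
     \sum_(0 <= j < n) 'C(2 * j, j)%:R + p%:R * y :> R.
    elim=> [|n IH] lt_n; first by exists 0; rewrite !big_nil mulr0 addr0.
    have [y ey] := IH (ltnW lt_n); have [x ex] := binP n lt_n.
    by exists (y + x * 'C(2 * n, n)%:R); rewrite !big_nat_recr //= ey ex; ring.
  exact.
have u2 := unit2_mod_prime_sqr p_pr p_gt2 p2.
have ec2 : (e - c) ^+ 2 = 0.
  apply: (mulrI u2); apply: (mulrI u2).
  transitivity ((2%:R * e - c - c) ^+ 2); first by ring.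
  by rewrite ey addrAC subrr add0r exprMn P2 !mulr0 mul0r.
have c2 : c ^+ 2 = 1 by apply: chi3_sqr.
have e2 : e ^+ 2 = 2%:R * c * e - 1.
  transitivity ((e - c) ^+ 2 + 2%:R * c * e - c ^+ 2); first by ring.
  by rewrite ec2 c2 add0r.
have -> : 9%:R ^+ p.-1 = (e ^+ 2) ^+ 2.
  rewrite (_ : p.-1 = 2 * h)%N; last by rewrite ph.
  rewrite /e !(exprAC _ h) exprM.
  by congr (_ ^+ _); ring.
(* What remains is 4e - 3c = c e^4, which follows from e^2 = 2ce - 1 and c^2 = 1. *)
rewrite domE e2.
transitivity (c * (4%:R * c ^+ 2 * e ^+ 2 - 4%:R * c * e + 1)); last by ring.
rewrite c2 e2.
transitivity (4%:R * (2%:R * c ^+ 2 * e - c) - 4%:R * c ^+ 2 * e + c); last by ring.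
by rewrite c2; ring.
Qed.

(** * The Legendre symbol of -3 *)

Lemma Fp_expr_p (p : nat) (x : 'F_p) : prime p -> x ^+ p = x.
Proof. by move=> p_pr; have := expf_card x; rewrite card_Fp. Qed.

(** X^q - 1 cannot vanish at all 3q nonzero elements; the q-th power of a non-root is the
    witness. *)
Lemma cube_root_Fp (p q : nat) :
  prime p -> p = (3 * q + 1)%N -> (0 < q)%N ->
  exists2 w : 'F_p, w ^+ 3 = 1 & w != 1.
Proof.
move=> p_pr pq q_gt0.
pose s := enum (predC1 (0 : 'F_p)).
have s_size : size s = (3 * q)%N.
  by have := cardC1 (0 : 'F_p); rewrite -cardE card_Fp // => ->; lia.
have [all_unity|] := boolP (all q.-unity_root s).
  by have := max_unity_roots q_gt0 all_unity (enum_uniq _); rewrite s_size; lia.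
case/allPn => x; rewrite mem_enum /= => x_neq0; rewrite unity_rootE => xq_neq1.
exists (x ^+ q); last by [].
apply: (mulfI x_neq0); rewrite -exprM -exprS mulr1 mulnC -addn1 -pq.
exact: Fp_expr_p.
Qed.

(** -3 = (2w + 1)^2 for a primitive cube root of unity w. If p = 3q + 2, then w^p = w and w^3 = 1
    force w = 1, hence 3 = 0. *)
Lemma legendre_m3 (p : nat) : prime p -> (3 < p)%N -> legendre (-3) p = chi3 int p.
Proof.
move=> p_pr p_gt3; rewrite /legendre.
have p0 : p%:R = 0 :> 'F_p by apply: pchar_Fp_0.
have three_neq0 : 3%:R != 0 :> 'F_p by apply: (natr_neq0_lt p_pr p0); rewrite p_gt3.
have two_neq0 : 2%:R != 0 :> 'F_p by apply: (natr_neq0_lt p_pr p0); apply: ltnW.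
have -> : (-3)%:~R = - 3%:R :> 'F_p by rewrite rmorphN.
rewrite oppr_eq0 (negPf three_neq0).
have [q [r [pE r_lt3]]] := mod3P p.
case: r r_lt3 pE => [|[|[|//]]] _ pE.
- have : (3 %| p)%N by rewrite pE addn0 dvdn_mulr.
  by rewrite dvdn_prime2 // => /eqP; lia.
- rewrite [RHS](_ : _ = 1); last by rewrite pE chi3E.
  have q_gt0 : (0 < q)%N by lia.
  have [w w3 w_neq1] := cube_root_Fp p_pr pE q_gt0.
  case: existsP => // -[]; exists (2%:R * w + 1).
  have : (w - 1) * (w ^+ 2 + w + 1) = 0 by transitivity (w ^+ 3 - 1); [ring | rewrite w3 subrr].
  move/eqP; rewrite mulf_eq0 subr_eq0 (negPf w_neq1) /= => /eqP w2.
  apply/eqP; transitivity (4%:R * (w ^+ 2 + w + 1) - 3%:R); first by ring.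
  by rewrite w2 mulr0 sub0r.
- rewrite [RHS](_ : _ = -1); last by rewrite pE chi3E.
  case: existsP => // -[x /eqP x2].
  pose w := (x - 1) / 2%:R.
  have w2 : w ^+ 2 + w + 1 = 0.
    apply: (mulfI (expf_neq0 2 two_neq0)); rewrite mulr0.
    transitivity (x ^+ 2 + 3%:R); first by rewrite /w; field.
    by rewrite x2 addNr.
  have w3 : w ^+ 3 = 1.
    transitivity ((w - 1) * (w ^+ 2 + w + 1) + 1); first by ring.
    by rewrite w2 mulr0 add0r.
  have := Fp_expr_p w p_pr.
  rewrite (congr1 (GRing.exp w) pE) exprD exprM w3 expr1n mul1r => ww.
  have w_neq0 : w != 0 by apply/eqP => w0; move/eqP: w3; rewrite w0 expr0n eq_sym oner_eq0.
  have w1 : w = 1 by apply: (mulfI w_neq0); rewrite mulr1.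
  move: w2; rewrite w1 expr1n => /eqP.
  by rewrite (_ : 1 + 1 + 1 = 3%:R) ?(negPf three_neq0) //; ring.
Qed.

(** * From integers modulo p^2 to rationals modulo p^3 *)

Lemma int_dvd_Zp (n : nat) (x : int) : (1 < n)%N -> x%:~R = 0 :> 'Z_n -> (n%:Z %| x)%Z.
Proof.
move=> n_gt1 x0; rewrite dvdzE /=.
have : (`|x|%N)%:R = 0 :> 'Z_n.
  have := congr1 (fun i : int => (-1) ^+ (x < 0)%R * i%:~R : 'Z_n) (intEsign x).
  by rewrite x0 mulr0 rmorphM rmorph_sign mulrA -expr2 sqrr_sign mul1r => e; exact: esym e.
by move/(congr1 val); rewrite /= val_Zp_nat // => /eqP.
Qed.

Lemma p_integral_div (p : nat) (z : int) m :
  prime p -> (3 < p)%N -> p_integral p (z%:~R / 9%:R ^+ m).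
Proof.
move=> p_pr p_gt3; set x := _ / _; rewrite /p_integral; apply/negP => p_dvd.
have e : numq x * 9%:R ^+ m = z * denq x.
  apply: (mulrIz (@oner_neq0 rat)); rewrite !rmorphM rmorphXn /=.
  have d_neq0 : (denq x)%:~R != 0 :> rat by rewrite intr_eq0 denq_eq0.
  have : (numq x)%:~R = x * (denq x)%:~R by rewrite -{2}(divq_num_den x) divfK.
  by move=> ->; rewrite /x; field; rewrite expf_neq0.
have : (denq x %| 9%:R ^+ m)%Z.
  have co : coprimez (denq x) (numq x) by rewrite coprimez_sym coprimezE coprime_num_den.
  by rewrite -(Gauss_dvdzr _ co) e dvdz_mull.
move/(dvdz_trans p_dvd); rewrite dvdzE abszX /= Euclid_dvdX //.
case/andP=> p_dvd9 _; have : (p %| 3 ^ 2)%N by [].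
by rewrite Euclid_dvdX // dvdn_prime2 // => /andP[/eqP]; lia.
Qed.

Theorem theorem1p3 (p : nat) (p_prime : prime p) (p_ge5 : (5 <= p)%N) :
  eqmod_rat p 3
    (\sum_(0 <= k < p) (2 * k + 1)%N%:R / (-9%:R) ^+ k * AZ k)
    ((legendre (-3) p)%:~R * p%:R).
Proof.
have p_gt3 : (3 < p)%N by apply: ltnW.
have p_gt0 := prime_gt0 p_prime.
have odd_p : odd p by case/even_prime: p_prime p_gt3 => ->.
have p1 : p.-1.+1 = p by rewrite prednK.
have sign_p1 : (-1) ^+ p.-1 = 1 :> int.
  by rewrite -signr_odd; move: odd_p; rewrite -{1}p1 /= => /negPf ->.
pose c k : nat := (honeycomb k * 'C(p, k.+1) * 'C(p + k, k))%N.
(* 9^(p-1) times the sum on the right of [AZ_sum]; the factor p in front of that sum later raises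
   p^2 to p^3. *)
pose X : int := \sum_(0 <= k < p) (-1) ^+ k * 9%:R ^+ (p.-1 - k) * (c k)%:R.
have [z Xz] : exists z : int, X = legendre (-3) p * 9%:R ^+ p.-1 + z * (p ^ 2)%N%:Z.
  suff /dvdzP[z e] : ((p ^ 2)%N%:Z %| X - legendre (-3) p * 9%:R ^+ p.-1)%Z.
    by exists z; rewrite -e addrC subrK.
  have p2_gt1 : (1 < p ^ 2)%N by rewrite -(exp1n 2) ltn_exp2r // ltnW // ltnW.
  have -> : X = \sum_(0 <= k < p.-1) (-1) ^+ k * 9%:R ^+ (p.-1 - k) * (c k)%:R + (c p.-1)%:R.
    by rewrite /X -{1}p1 big_nat_recr //= subnn sign_p1 !mul1r.
  rewrite -addrA; apply: rpredD; first exact: honeycomb_sum_dvd.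
  apply: int_dvd_Zp => //.
  have p2 : (p ^ 2)%:R = 0 :> 'Z_(p ^ 2) by rewrite pchar_Zp.
  rewrite rmorphB legendre_m3 // [X in _ - X]rmorphM rmorphXn /= !mulrz_nat.
  have -> : (chi3 int p)%:~R = chi3 'Z_(p ^ 2) p.
    by rewrite /chi3; case: (p %% 3)%N (ltn_mod p 3) => [|[|[|]]].
  (* The last term is a(p-1) C(2p-1, p-1), whose binomial is 1 modulo p^2. *)
  rewrite /c p1 binn muln1 natrM (bin_2p_pred p_prime (ltnW p_gt3) p2) mulr1.
  by rewrite honeycomb_pred_prime // subrr.
exists (z%:~R / 9%:R ^+ p.-1); first exact: p_integral_div.
have nine_neq0 m : 9%:R ^+ m != 0 :> rat by rewrite expf_neq0.
have sumE : \sum_(0 <= k < p) (-9%:R) ^- k * (c k)%:R = X%:~R / 9%:R ^+ p.-1 :> rat.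
  rewrite /X rmorph_sum /= mulr_suml; apply: eq_big_nat => k /andP[_ lt_kp].
  rewrite !rmorphM rmorph_sign rmorphXn /= !mulrz_nat.
  have -> : 9%:R ^+ p.-1 = 9%:R ^+ (p.-1 - k) * 9%:R ^+ k :> rat.
    by rewrite -exprD subnK //; lia.
  rewrite (exprNn 9%:R) invfM -exprVn invrN1.
  by field; rewrite !nine_neq0.
have p2E : ((p ^ 2)%N%:Z)%:~R = p%:R ^+ 2 :> rat by rewrite -natrX.
rewrite AZ_sum sumE Xz intrD (intrM _ (legendre _ _)) (intrM _ z) rmorphXn /= p2E.
by field; rewrite nine_neq0.
Qed.
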